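(* Let $d\ge2$, $n=\lfloor d/2\rfloor$, $\lambda\in\mathbb{C}^d$, $|\lambda|=|\lambda_1|+\dots+|\lambda_d|$, and $$R'=\frac{c_{2n+1}^{\,n}}{2^{10n-1}\,n\,\pi^2\,(1+|\lambda|)^{4n+1}},\qquad c_{2n+1}=\int_0^{2\pi}(\cos\theta)^{2n}(\sin\theta)^2\,d\theta .$$ Then the function $f_\lambda(x)=x+\sum_{k\ge2}v_k(2\pi)(\lambda)\,x^k$ of the complex variable $x$ has at most $2n$ zeros (counted with multiplicity) in the disc $D(0,R')$.
   Context: Let $\lambda=(\lambda_1,\dots,\lambda_d)$ be parameters and $p(x)=\sum_{i=1}^d\lambda_i x^i$. For real $\lambda$ consider the Liénard system $\dot x=y$, $\dot y=-x+p(x)y$; in polar coordinates $x=r\cos\theta$, $y=r\sin\theta$ its orbits satisfy $$\frac{dr}{d\theta}=\frac{r\,p(r\cos\theta)\sin^2\theta}{-1+\sin\theta\cos\theta\,p(r\cos\theta)}.$$ For small $r_0$ let $r(\theta;r_0)$ be the solution with $r(0;r_0)=r_0$; for each $\theta$ the inverse of $r_0\mapsto r(\theta;r_0)$ has the expansion $r_0=r+\sum_{k\ge2}v_k(\theta)r^k$, where each $v_k(\theta)$ is a polynomial in $\lambda$ with real coefficients. The function $f_\lambda$ is the analytic continuation to complex $x$ (and complex $\lambda$, by evaluating the polynomials $v_k(2\pi)$ at complex arguments) of the inverse of the first return mapping. *)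

(* Defs.v *)
From Stdlib Require Import Reals List Factorial.
From Coquelicot Require Import Coquelicot.
Open Scope R_scope.

(* Parameter vectors lambda = (lambda_1,...,lambda_d) are functions nat -> R
   (resp. nat -> C); only the entries 1..d are used. *)

Definition liep (d : nat) (lam : nat -> R) (x : R) : R :=
  fold_right (fun i acc => lam i * x ^ i + acc) 0 (seq 1 d).

Definition polar_den (d : nat) (lam : nat -> R) (th r : R) : R :=
  -1 + sin th * cos th * liep d lam (r * cos th).

Definition polar_rhs (d : nat) (lam : nat -> R) (th r : R) : R :=
  r * liep d lam (r * cos th) * (sin th) ^ 2 / polar_den d lam th r.

(* A polynomial in lambda with real coefficients: a finite list of monomials
   c * prod_{i=1}^d lambda_i^(e i). *)
Definition rpoly := list (R * (nat -> nat)).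

Definition rpoly_eval (d : nat) (P : rpoly) (lam : nat -> R) : R :=
  fold_right (fun m acc =>
    fst m * fold_right (fun i a => lam i ^ (snd m i) * a) 1 (seq 1 d) + acc) 0 P.

Definition rpoly_evalC (d : nat) (P : rpoly) (lam : nat -> C) : C :=
  fold_right (fun m acc =>
    Cplus (Cmult (RtoC (fst m))
             (fold_right (fun i a => Cmult (pow_n (lam i) (snd m i)) a) (RtoC 1) (seq 1 d)))
          acc) (RtoC 0) P.

(* Specification of the polynomials v_k(2 pi) (k >= 2): for every real lambda,
   for small r0 >= 0 the solution r(theta; r0) with r(0; r0) = r0 exists on
   [0, 2 pi], and the inverse of the first return map r0 |-> r(2 pi; r0) is
   r0 = r + sum_{k>=2} v_k(2 pi)(lambda) r^k  with r = r(2 pi; r0). *)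
Definition return_inverse_spec (d : nat) (v : nat -> rpoly) : Prop :=
  forall lam : nat -> R,
  exists delta : R, 0 < delta /\
  exists sol : R -> R -> R,
    forall r0 : R, 0 <= r0 < delta ->
      sol 0 r0 = r0 /\
      (forall th : R, 0 <= th <= 2 * PI ->
         polar_den d lam th (sol th r0) <> 0 /\
         is_derive (fun t => sol t r0) th (polar_rhs d lam th (sol th r0))) /\
      is_series (fun k : nat => match k with
                              | O => 0
                              | S O => sol (2 * PI) r0
                              | _ => rpoly_eval d (v k) lam * (sol (2 * PI) r0) ^ k
                              end) r0.

Definition fcoef (d : nat) (v : nat -> rpoly) (lam : nat -> C) (k : nat) : C :=
  match k with
  | O => RtoC 0
  | S O => RtoC 1
  | _ => rpoly_evalC d (v k) lam
  end.

(* The power series sum_k a_k x^k has a zero of order >= m at z: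
   its j-th derivative (termwise: sum_k a_(k+j) (k+j)!/k! z^k) vanishes for all j < m. *)
Definition zero_order_ge (a : nat -> C) (z : C) (m : nat) : Prop :=
  forall j : nat, (j < m)%nat ->
    is_series (fun k : nat =>
      Cmult (Cmult (a (k + j)%nat) (RtoC (INR (Factorial.fact (k + j)) / INR (Factorial.fact k))))
            (pow_n z k)) (RtoC 0).

Definition lam_norm (d : nat) (lam : nat -> C) : R :=
  fold_right (fun i acc => Cmod (lam i) + acc) 0 (seq 1 d).

Definition c_odd (n : nat) : R :=
  RInt (fun t => (cos t) ^ (2 * n) * (sin t) ^ 2) 0 (2 * PI).

Definition Rprime (d : nat) (lam : nat -> C) : R :=
  let n := (d / 2)%nat in
  (c_odd n) ^ n /
  (2 ^ (10 * n - 1) * INR n * PI ^ 2 * (1 + lam_norm d lam) ^ (4 * n + 1)).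

(* Main.v *)
Require Import Defs.
From Stdlib Require Import Reals List.
From Coquelicot Require Import Coquelicot.
From Stdlib Require Import Lra Lia Psatz Classical_Prop.
Open Scope R_scope.

(** Since [f(x) = x + ...], it suffices to bound the coefficients: if
    [|v_k(2 pi)| <= 2 Q^(k-1)] with [Q = 36 (1 + |lambda|)], then on [Q |x| <= 1/4]
    the only zero of [f] is the simple zero at the origin, and [R' < 1/(4 Q)].

    The coefficients are [v_k = sum_w c_w(theta) lambda^w] over the words [w] in the
    letters [1..d] of weight [k - 1], where the [c_w] solve a linear recursion that
    expresses that [sum_k v_k r^k] is a first integral, and
    [|c_w(theta)| <= (2 + 2 theta)^|w|].  For real [lambda], the sum over words of
    length at most [M] varies by only [O(r^(M+2))] along a solution, so the
    expansion of the inverse return map must have these coefficients; the identity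
    of polynomials then extends to complex [lambda]. *)

(** The obstacle is that [return_inverse_spec] describes the polynomials only indirectly: for each
    real parameter separately it gives a convergent series on an interval that depends on the
    parameter, with no uniformity and no equation in theta. Hence the coefficients are produced
    independently and matched by uniqueness of asymptotic expansions. Working with finite sums of
    words avoids proving that the first integral converges: truncation leaves a single error term,
    carried by the longest words. Words are used instead of monomials because multiplication by [p]
    just prepends a letter, so every word has one predecessor, and because the sum of |lambda^w|
    over words of a fixed length is a power of a sum over letters. Constants: at theta = 2 pi the
    base 2 + 2 theta is at most 18 (from pi <= 4); a further factor 2 (1 + |lambda|) makes the sum
    over word lengths geometric of ratio at most 1/2, whence 36 (1 + |lambda|) and the leading 2.
    With Q |x| <= 1/4 the terms after the linear one total at most 2 |x| (1/3), which is less than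
    |x|. *)

Definition lsum {A} (f : A -> R) (l : list A) : R :=
  fold_right (fun a acc => f a + acc) 0 l.

Lemma lsum_app A (f : A -> R) l1 l2 : lsum f (l1 ++ l2) = lsum f l1 + lsum f l2.
Proof. induction l1 as [|a l1 IH]; simpl; [ring | rewrite IH; ring]. Qed.

Lemma lsum_map A B (f : B -> R) (g : A -> B) l :
  lsum f (map g l) = lsum (fun a => f (g a)) l.
Proof. induction l as [|a l IH]; simpl; [reflexivity | now rewrite IH]. Qed.

Lemma lsum_flat_map A B (f : B -> R) (g : A -> list B) l :
  lsum f (flat_map g l) = lsum (fun a => lsum f (g a)) l.
Proof.
  induction l as [|a l IH]; simpl; [reflexivity|].
  rewrite lsum_app, IH. reflexivity.
Qed.

Lemma lsum_ext A (f g : A -> R) l :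
  (forall a, In a l -> f a = g a) -> lsum f l = lsum g l.
Proof.
  induction l as [|a l IH]; simpl; intros H; [reflexivity|].
  rewrite H, IH; auto.
Qed.

Lemma lsum_scal A (f : A -> R) c l : lsum (fun a => c * f a) l = c * lsum f l.
Proof. induction l as [|a l IH]; simpl; [ring | rewrite IH; ring]. Qed.

Lemma lsum_plus A (f g : A -> R) l :
  lsum (fun a => f a + g a) l = lsum f l + lsum g l.
Proof. induction l as [|a l IH]; simpl; [ring | rewrite IH; ring]. Qed.

Lemma lsum_le A (f g : A -> R) l :
  (forall a, In a l -> f a <= g a) -> lsum f l <= lsum g l.
Proof.
  induction l as [|a l IH]; simpl; intros H; [lra|].
  apply Rplus_le_compat; auto.
Qed.

Lemma lsum_abs A (f : A -> R) l : Rabs (lsum f l) <= lsum (fun a => Rabs (f a)) l.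
Proof.
  induction l as [|a l IH]; simpl; [rewrite Rabs_R0; lra|].
  eapply Rle_trans; [apply Rabs_triang | lra].
Qed.

Lemma lsum_nonneg A (f : A -> R) l : (forall a, 0 <= f a) -> 0 <= lsum f l.
Proof.
  intros H; induction l as [|a l IH]; simpl; [lra|]. specialize (H a); lra.
Qed.

Lemma is_derive_lsum A (f : A -> R -> R) (df : A -> R) l t :
  (forall a, In a l -> is_derive (f a) t (df a)) ->
  is_derive (fun s => lsum (fun a => f a s) l) t (lsum df l).
Proof.
  induction l as [|a l IH]; simpl; intros H.
  - apply @is_derive_const.
  - apply (is_derive_plus (f a) (fun s => lsum (fun a => f a s) l)); auto.
Qed.

(** * Words and their coefficients *)

(* The letter [i] stands for the parameter [lambda_i]; a word of weight [k - 1]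
   contributes to the coefficient of [r^k]. *)
Fixpoint words (d m : nat) : list (list nat) :=
  match m with
  | O => nil :: nil
  | S m => flat_map (fun i => map (cons i) (words d m)) (seq 1 d)
  end.

Fixpoint words_below (d M : nat) : list (list nat) :=
  match M with
  | O => nil
  | S M => words_below d M ++ words d M
  end.

Lemma words_spec d m w :
  In w (words d m) -> length w = m /\ (forall i, In i w -> (1 <= i <= d)%nat).
Proof.
  revert w; induction m as [|m IH]; simpl; intros w H.
  - destruct H as [<-|[]]. split; [reflexivity | intros i []].
  - apply in_flat_map in H. destruct H as [i [Hi H]].
    apply in_map_iff in H. destruct H as [s [<- Hs]].
    apply in_seq in Hi. destruct (IH s Hs) as [H1 H2].
    split; [simpl; congruence|].
    intros j [<-|Hj]; [lia | auto].
Qed.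

Lemma words_below_letters d M w :
  In w (words_below d M) -> forall i, In i w -> (1 <= i <= d)%nat.
Proof.
  induction M as [|M IH]; simpl; intros H; [destruct H|].
  apply in_app_or in H. destruct H as [H|H]; [auto|].
  now apply words_spec in H.
Qed.

Lemma length_le_weight w : (forall i, In i w -> (1 <= i)%nat) -> (length w <= list_sum w)%nat.
Proof.
  induction w as [|i w IH]; simpl; intros H; [lia|].
  assert (1 <= i)%nat by auto.
  assert (length w <= list_sum w)%nat by auto.
  unfold list_sum in *; simpl; lia.
Qed.

(* The pair [(c_w, c_w')].  Writing the first integral as
   [F = sum_w c_w(theta) lambda^w r^(1 + |w|)], the equation
   [F_theta = p (sin cos F_theta + sin^2 r F_r)] is this recursion on words. *)
Fixpoint wcoef (w : list nat) : (R -> R) * (R -> R) :=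
  match w with
  | nil => (fun _ => 1, fun _ => 0)
  | i :: s =>
      let dc := fun t => sin t * cos t ^ S i * snd (wcoef s) t
                  + sin t ^ 2 * cos t ^ i * INR (S (list_sum s)) * fst (wcoef s) t in
      (fun t => RInt dc 0 t, dc)
  end.

Lemma wcoef_derive w :
  (forall t, is_derive (fst (wcoef w)) t (snd (wcoef w) t)) /\
  (forall t, ex_derive (snd (wcoef w)) t).
Proof.
  induction w as [|i s [IH1 IH2]].
  - split; intros t; simpl; [apply @is_derive_const | apply @ex_derive_const].
  - assert (H : forall t, ex_derive (snd (wcoef (i :: s))) t).
    { intros t. simpl. auto_derive. repeat split; auto.
      exists (snd (wcoef s) t). apply IH1. }
    split; [|exact H]. intros t.
    apply (is_derive_RInt (snd (wcoef (i :: s))) _ 0).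
    + apply filter_forall. intros u. simpl fst.
      apply (RInt_correct (snd (wcoef (i :: s)))).
      apply ex_RInt_continuous. intros z _.
      apply (ex_derive_continuous (snd (wcoef (i :: s)))), H.
    + apply (ex_derive_continuous (snd (wcoef (i :: s)))), H.
Qed.

Lemma wcoef_0 i s : fst (wcoef (i :: s)) 0 = 0.
Proof. exact (RInt_point 0 (snd (wcoef (i :: s)))). Qed.

Lemma Rabs_pow_le_1 x n : Rabs x <= 1 -> Rabs (x ^ n) <= 1.
Proof.
  intros H. rewrite <- RPow_abs. rewrite <- (pow1 n).
  apply pow_incr. split; [apply Rabs_pos | exact H].
Qed.

Lemma Rabs_sin_le_1 t : Rabs (sin t) <= 1.
Proof. apply Rabs_le, SIN_bound. Qed.

Lemma Rabs_cos_le_1 t : Rabs (cos t) <= 1.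
Proof. apply Rabs_le, COS_bound. Qed.

Lemma Rabs_mult_le_1 x y : Rabs x <= 1 -> Rabs y <= 1 -> Rabs (x * y) <= 1.
Proof.
  intros Hx Hy. rewrite Rabs_mult.
  generalize (Rabs_pos x) (Rabs_pos y). nra.
Qed.

(** The second bound is the derivative of the first, so the induction only has to propagate the
    derivative bound and then integrate from 0. The base 2 + 2t is at least 2, which absorbs the
    factor 2 in front of the old derivative bound. *)
Lemma wcoef_bound w :
  (forall i, In i w -> (1 <= i)%nat) -> forall t, 0 <= t ->
  Rabs (fst (wcoef w) t) <= (2 + 2 * t) ^ list_sum w /\
  Rabs (snd (wcoef w) t) <= 2 * INR (list_sum w) * (2 + 2 * t) ^ pred (list_sum w).
Proof.
  induction w as [|i s IH]; intros Hw.
  - intros t Ht. simpl. rewrite Rabs_R0, Rabs_R1. lra.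
  - assert (Hi : (1 <= i)%nat) by (apply Hw; now left).
    specialize (IH (fun j Hj => Hw j (or_intror Hj))).
    change (list_sum (i :: s)) with (i + list_sum s)%nat.
    set (N := list_sum s) in *.
    assert (Hd : forall t, 0 <= t ->
      Rabs (snd (wcoef (i :: s)) t) <= 2 * INR (i + N) * (2 + 2 * t) ^ pred (i + N)).
    { intros t Ht. destruct (IH t Ht) as [Hc Hdc].
      assert (HX : 1 <= (2 + 2 * t) ^ N) by (apply pow_R1_Rle; lra).
      assert (Hmono : (2 + 2 * t) ^ N <= (2 + 2 * t) ^ pred (i + N))
        by (apply Rle_pow; [lra | lia]).
      assert (Hdc' : Rabs (snd (wcoef s) t) <= INR N * (2 + 2 * t) ^ N).
      { eapply Rle_trans; [exact Hdc|]. destruct N as [|N']; [simpl; lra|].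
        simpl pred. rewrite <- tech_pow_Rmult.
        assert (0 <= INR (S N') * (2 + 2 * t) ^ N').
        { apply Rmult_le_pos; [apply pos_INR | apply pow_le; lra]. }
        nra. }
      simpl. fold N.
      eapply Rle_trans; [apply Rabs_triang|].
      assert (H1 : Rabs (sin t * (cos t * cos t ^ i) * snd (wcoef s) t)
                   <= INR N * (2 + 2 * t) ^ N).
      { rewrite Rabs_mult.
        assert (Rabs (sin t * (cos t * cos t ^ i)) <= 1).
        { apply Rabs_mult_le_1; [apply Rabs_sin_le_1|].
          apply Rabs_mult_le_1; [|apply Rabs_pow_le_1]; apply Rabs_cos_le_1. }
        generalize (Rabs_pos (snd (wcoef s) t)). nra. }
      assert (H2 : Rabs (sin t * (sin t * 1) * cos t ^ i * INR (S N) * fst (wcoef s) t)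
                   <= INR (S N) * (2 + 2 * t) ^ N).
      { rewrite !Rabs_mult with (y := fst (wcoef s) t).
        rewrite Rabs_mult with (y := INR (S N)), (Rabs_right (INR (S N)))
          by (apply Rle_ge, pos_INR).
        assert (Rabs (sin t * (sin t * 1) * cos t ^ i) <= 1).
        { apply Rabs_mult_le_1; [|apply Rabs_pow_le_1, Rabs_cos_le_1].
          rewrite Rmult_1_r. apply Rabs_mult_le_1; apply Rabs_sin_le_1. }
        apply Rmult_le_compat; [| apply Rabs_pos | | exact Hc].
        - apply Rmult_le_pos; [apply Rabs_pos | apply pos_INR].
        - generalize (pos_INR (S N)); nra. }
      change (match N with O => 1 | S _ => INR N + 1 end) with (INR (S N)).
      eapply Rle_trans; [apply Rplus_le_compat; [exact H1 | exact H2]|].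
      (* The two terms of the recursion contribute N and N + 1 times the power of exponent N; a
         letter is at least 1, which leaves room for the sum. *)
      assert (HN : 2 * INR N + 1 <= 2 * INR (i + N)).
      { rewrite plus_INR. apply le_INR in Hi. simpl in Hi. lra. }
      rewrite S_INR.
      generalize (pos_INR N). intros HN0.
      apply Rle_trans with ((2 * INR N + 1) * (2 + 2 * t) ^ N); [lra|].
      apply Rmult_le_compat; lra. }
    intros t Ht. split; [|now apply Hd].
    set (K := (i + N)%nat) in *.
    assert (HI : is_RInt (snd (wcoef (i :: s))) 0 t (fst (wcoef (i :: s)) t)).
    { apply (RInt_correct (snd (wcoef (i :: s)))).
      apply ex_RInt_continuous. intros z _.
      apply (ex_derive_continuous (snd (wcoef (i :: s)))), wcoef_derive. }
    assert (HJ : is_RInt (fun t => 2 * INR K * (2 + 2 * t) ^ pred K) 0 t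
                   (minus ((2 + 2 * t) ^ K) ((2 + 2 * 0) ^ K))).
    { apply (is_RInt_derive (fun t => (2 + 2 * t) ^ K)).
      - intros x _. auto_derive; [trivial | ring].
      - intros x _. apply (ex_derive_continuous (fun t => 2 * INR K * (2 + 2 * t) ^ pred K)).
        auto_derive. trivial. }
    assert (HL : norm (fst (wcoef (i :: s)) t) <= minus ((2 + 2 * t) ^ K) ((2 + 2 * 0) ^ K)).
    { apply (norm_RInt_le _ _ _ _ _ _ Ht) with (2 := HI) (3 := HJ).
      intros x [Hx _]. now apply Hd. }
    change (Rabs (fst (wcoef (i :: s)) t) <= (2 + 2 * t) ^ K - (2 + 2 * 0) ^ K) in HL.
    assert (0 <= (2 + 2 * 0) ^ K) by (apply pow_le; lra).
    lra.
Qed.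

(** * Bootstrap principle and size of [liep] *)

(** Continuity argument: the weak bound 2b improves itself to b, so the supremum of the times up to
    which b holds cannot lie before [T]. *)
Lemma continuity_trap (f : R -> R) (T b : R) :
  0 <= T -> 0 < b -> f 0 = 0 ->
  (forall t, 0 <= t <= T -> continuous f t) ->
  (forall t, 0 <= t <= T -> (forall s, 0 <= s <= t -> Rabs (f s) <= 2 * b) ->
     Rabs (f t) <= b) ->
  forall t, 0 <= t <= T -> Rabs (f t) <= b.
Proof.
  intros HT Hb H0 Hc Hstep.
  set (E := fun t => 0 <= t <= T /\ forall s, 0 <= s <= t -> Rabs (f s) <= b).
  assert (E0 : E 0).
  { split; [lra|]. intros s Hs. replace s with 0 by lra. rewrite H0, Rabs_R0. lra. }
  destruct (completeness E) as [tau [Hub Hlub]].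
  { exists T. intros t [Ht _]. lra. }
  { now exists 0. }
  assert (Htau : 0 <= tau <= T).
  { split; [now apply Hub|]. apply Hlub. intros t [Ht _]. lra. }
  destruct (proj1 (filterlim_locally f (f tau)) (Hc tau Htau) (mkposreal (b / 2) ltac:(lra)))
    as [[del Hdel] Hnear].
  assert (Hn : forall s, Rabs (s - tau) < del -> Rabs (f s - f tau) < b / 2).
  { intros s Hs. apply (Hnear s). exact Hs. }
  clear Hnear. simpl in Hn.
  assert (Hex : exists t', E t' /\ tau - del < t').
  { apply NNPP. intros Hno.
    assert (tau <= tau - del); [|lra].
    apply Hlub. intros t Ht. apply Rnot_lt_le. intros Hlt. apply Hno. now exists t. }
  destruct Hex as [t' [[Ht' HE] Hlt]].
  assert (t' <= tau) by (apply Hub; now split).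
  (* Continuity with tolerance b/2 is used twice: from [t'] to [tau] it costs b/2, and from [tau] to
     its neighbours another b/2, which stays within the 2b that [Hstep] accepts. *)
  assert (Hftau : Rabs (f tau) <= 3 * b / 2).
  { assert (A1 := HE t' ltac:(lra)).
    assert (A2 : Rabs (f t' - f tau) < b / 2) by (apply Hn, Rabs_def1; lra).
    apply Rabs_def2 in A2. apply Rabs_le_between in A1. apply Rabs_le. lra. }
  assert (Hall : forall s, 0 <= s <= T -> s < tau + del -> Rabs (f s) <= b).
  { intros s Hs Hs'. apply Hstep; [exact Hs|]. intros u Hu.
    destruct (Rle_dec u t') as [Hle|Hgt].
    - assert (A := HE u ltac:(lra)). lra.
    - assert (A2 : Rabs (f u - f tau) < b / 2) by (apply Hn, Rabs_def1; lra).
      apply Rabs_def2 in A2. apply Rabs_le_between in Hftau. apply Rabs_le. lra. }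
  destruct (Rlt_dec tau T) as [HtT|HtT].
  - exfalso. set (u := Rmin T (tau + del / 2)).
    assert (Hu : tau < u <= T /\ u < tau + del).
    { unfold u, Rmin. destruct (Rle_dec T (tau + del / 2)); lra. }
    assert (u <= tau); [|lra].
    apply Hub. split; [lra|]. intros s Hs. apply Hall; lra.
  - intros t Ht. apply Hall; lra.
Qed.

Definition lnorm (d : nat) (lam : nat -> R) : R := lsum (fun i => Rabs (lam i)) (seq 1 d).

Lemma liep_bound d lam x : Rabs x <= 1 -> Rabs (liep d lam x) <= lnorm d lam * Rabs x.
Proof.
  intros Hx.
  change (liep d lam x) with (lsum (fun i => lam i * x ^ i) (seq 1 d)).
  eapply Rle_trans; [apply lsum_abs|].
  unfold lnorm. rewrite Rmult_comm, <- lsum_scal.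
  apply lsum_le. intros i Hi. apply in_seq in Hi.
  rewrite Rabs_mult, Rmult_comm. apply Rmult_le_compat_r; [apply Rabs_pos|].
  destruct i as [|i]; [lia|]. simpl. rewrite Rabs_mult.
  assert (Rabs (x ^ i) <= 1) by now apply Rabs_pow_le_1.
  generalize (Rabs_pos x); nra.
Qed.

(** * Truncations of the first integral *)

Definition mon (lam : nat -> R) (w : list nat) : R := fold_right (fun i a => lam i * a) 1 w.

Definition psum (lam : nat -> R) (T : list (list nat)) (t r : R) : R :=
  lsum (fun w => fst (wcoef w) t * mon lam w * r ^ S (list_sum w)) T.

(* [psum_th] is the partial derivative of [psum] in [t]; [psum_r] is the partial
   derivative in [r], multiplied by [r]. *)
Definition psum_th (lam : nat -> R) (T : list (list nat)) (t r : R) : R :=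
  lsum (fun w => snd (wcoef w) t * mon lam w * r ^ S (list_sum w)) T.

Definition psum_r (lam : nat -> R) (T : list (list nat)) (t r : R) : R :=
  lsum (fun w => fst (wcoef w) t * mon lam w * INR (S (list_sum w)) * r ^ S (list_sum w)) T.

(** Split off the first letter [i]: the factors lambda_i r^i cos^i sum to [liep], and what remains
    is the recursion of [wcoef]. *)
Lemma psum_th_words_S d lam m t r :
  psum_th lam (words d (S m)) t r =
  liep d lam (r * cos t) *
    (sin t * cos t * psum_th lam (words d m) t r + sin t ^ 2 * psum_r lam (words d m) t r).
Proof.
  unfold psum_th at 1. simpl words. rewrite lsum_flat_map.
  change (liep d lam (r * cos t)) with (lsum (fun i => lam i * (r * cos t) ^ i) (seq 1 d)).
  rewrite Rmult_comm, <- lsum_scal. apply lsum_ext. intros i _.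
  rewrite lsum_map. unfold psum_th, psum_r.
  rewrite <- !lsum_scal, <- lsum_plus, Rmult_comm, <- lsum_scal.
  apply lsum_ext. intros w _.
  change (list_sum (i :: w)) with (i + list_sum w)%nat.
  change (mon lam (i :: w)) with (lam i * mon lam w).
  rewrite Rpow_mult_distr.
  replace (r ^ S (i + list_sum w)) with (r ^ i * r ^ S (list_sum w))
    by (rewrite <- pow_add; f_equal; lia).
  cbn [wcoef snd]. simpl (cos t ^ S i). ring.
Qed.

(** The operator on the left raises word length by one, so lengths 0..M-1 become 1..M. The empty
    word has zero derivative, hence the only mismatch is the level of length [M]. *)
Lemma psum_th_telescope d lam M t r :
  liep d lam (r * cos t) *
    (sin t * cos t * psum_th lam (words_below d M) t r
     + sin t ^ 2 * psum_r lam (words_below d M) t r)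
  = psum_th lam (words_below d M) t r + psum_th lam (words d M) t r.
Proof.
  induction M as [|M IH].
  - unfold psum_th, psum_r. simpl. ring.
  - assert (A1 : psum_th lam (words_below d (S M)) t r
        = psum_th lam (words_below d M) t r + psum_th lam (words d M) t r)
      by apply lsum_app.
    assert (A2 : psum_r lam (words_below d (S M)) t r
        = psum_r lam (words_below d M) t r + psum_r lam (words d M) t r)
      by apply lsum_app.
    rewrite A1, A2, psum_th_words_S. nra.
Qed.

(** Normalisation of the first integral: every nonempty word vanishes at angle 0, so along an orbit
    the sum starts at r0. *)
Lemma psum_0 d lam M r : psum lam (words_below d (S M)) 0 r = r.
Proof.
  induction M as [|M IH].
  - unfold psum. simpl. ring.
  - assert (A1 : psum lam (words_below d (S (S M))) 0 r
        = psum lam (words_below d (S M)) 0 r + psum lam (words d (S M)) 0 r)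
      by apply lsum_app.
    rewrite A1, IH.
    enough (psum lam (words d (S M)) 0 r = 0) by lra.
    unfold psum.
    rewrite lsum_ext with (g := fun _ => 0 * 0); [rewrite lsum_scal; ring|].
    intros w Hw. apply words_spec in Hw.
    destruct w as [|i s]; [simpl in Hw; lia|].
    rewrite wcoef_0. ring.
Qed.

Lemma is_derive_mul_pow (c y : R -> R) (m t dc dy : R) n :
  is_derive c t dc -> is_derive y t dy ->
  is_derive (fun s => c s * m * y s ^ S n) t
    (dc * m * y t ^ S n + c t * m * INR (S n) * y t ^ n * dy).
Proof.
  intros Hc Hy. auto_derive.
  - repeat split; [now exists dc | now exists dy].
  - rewrite (is_derive_unique (fun x : R => c x) _ _ Hc),
      (is_derive_unique (fun x : R => y x) _ _ Hy).
    change (match n with O => 1 | S _ => INR n + 1 end) with (INR (S n)).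
    simpl (y t ^ S n). ring.
Qed.

(** The exact first integral would have derivative 0; by the telescoping identity the truncated one
    retains just the top level, of high order in r. *)
Lemma psum_derive d lam M (y : R -> R) t :
  polar_den d lam t (y t) <> 0 ->
  is_derive y t (polar_rhs d lam t (y t)) ->
  is_derive (fun s => psum lam (words_below d M) s (y s)) t
    (psum_th lam (words d M) t (y t) / polar_den d lam t (y t)).
Proof.
  intros Hden Hy.
  set (T := words_below d M).
  set (p := liep d lam (y t * cos t)).
  replace (psum_th lam (words d M) t (y t) / polar_den d lam t (y t)) with
    (lsum (fun w => snd (wcoef w) t * mon lam w * y t ^ S (list_sum w)
       + (p * sin t ^ 2 / polar_den d lam t (y t)) *
         (fst (wcoef w) t * mon lam w * INR (S (list_sum w)) * y t ^ S (list_sum w))) T).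
  - unfold psum. apply is_derive_lsum. intros w _.
    evar_last; [apply is_derive_mul_pow; [apply wcoef_derive | exact Hy]|].
    unfold polar_rhs. fold p. simpl (y t ^ S _). field. exact Hden.
  - rewrite lsum_plus, lsum_scal.
    fold (psum_th lam T t (y t)). fold (psum_r lam T t (y t)).
    assert (HT := psum_th_telescope d lam M t (y t)). fold p T in HT.
    replace (psum_th lam (words d M) t (y t)) with
      (p * (sin t * cos t * psum_th lam T t (y t) + sin t ^ 2 * psum_r lam T t (y t))
       - psum_th lam T t (y t)) by (rewrite HT; ring).
    revert Hden. unfold polar_den. fold p. intros Hden. field. exact Hden.
Qed.

Lemma psum_th_words_bound d lam M :
  exists C, 0 <= C /\ forall t r, 0 <= t <= 2 * PI -> Rabs r <= 1 ->
    Rabs (psum_th lam (words d M) t r) <= C * Rabs r ^ S M.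
Proof.
  exists (lsum (fun w => 2 * INR (list_sum w) * (2 + 2 * (2 * PI)) ^ pred (list_sum w)
            * Rabs (mon lam w)) (words d M)).
  assert (HPI := PI_RGT_0).
  split.
  { apply lsum_nonneg. intros w. apply Rmult_le_pos; [|apply Rabs_pos].
    apply Rmult_le_pos; [|apply pow_le; lra]. generalize (pos_INR (list_sum w)); lra. }
  intros t r Ht Hr. unfold psum_th.
  eapply Rle_trans; [apply lsum_abs|].
  rewrite Rmult_comm, <- lsum_scal. apply lsum_le. intros w Hw.
  apply words_spec in Hw. destruct Hw as [Hlen Hlet].
  rewrite !Rabs_mult, Rmult_comm, <- RPow_abs.
  (* Letters are at least 1, so length bounds weight from below; this turns truncation by length
     into an order in r. *)
  assert (Hle : (M <= list_sum w)%nat).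
  { rewrite <- Hlen. apply length_le_weight. intros i Hi. now apply Hlet. }
  apply Rmult_le_compat.
  - apply pow_le, Rabs_pos.
  - apply Rmult_le_pos; apply Rabs_pos.
  - replace (S (list_sum w)) with (S M + (list_sum w - M))%nat by lia.
    rewrite pow_add.
    assert (Rabs r ^ (list_sum w - M) <= 1).
    { rewrite <- (pow1 (list_sum w - M)). apply pow_incr. split; [apply Rabs_pos|exact Hr]. }
    assert (0 <= Rabs r ^ S M) by (apply pow_le, Rabs_pos).
    nra.
  - apply Rmult_le_compat_r; [apply Rabs_pos|].
    eapply Rle_trans; [apply wcoef_bound; [intros i Hi; now apply Hlet | lra]|].
    apply Rmult_le_compat_l; [generalize (pos_INR (list_sum w)); lra|].
    apply pow_incr. lra.
Qed.

(** * Orbits over one turn *)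

Lemma increment_bound (f df : R -> R) a b D :
  a <= b ->
  (forall t, a <= t <= b -> is_derive f t (df t) /\ Rabs (df t) <= D) ->
  Rabs (f b - f a) <= D * (b - a).
Proof.
  intros Hab H.
  destruct (MVT_gen f a b df) as [c [Hc Heq]];
    rewrite ?Rmin_left, ?Rmax_right in * by lra.
  - intros x Hx. apply H. lra.
  - intros x Hx. apply continuity_pt_filterlim.
    apply (ex_derive_continuous f). exists (df x). now apply H.
  - rewrite Heq, Rabs_mult, (Rabs_right (b - a)) by lra.
    apply Rmult_le_compat_r; [lra|]. now apply H.
Qed.

Lemma polar_den_bound d lam t r K :
  lnorm d lam <= K -> 1 <= K -> Rabs r <= / (2 * K) ->
  1 / 2 <= Rabs (polar_den d lam t r) /\
  Rabs (liep d lam (r * cos t)) <= K * Rabs r.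
Proof.
  intros HK HK1 Hr.
  assert (Hinv : K * / (2 * K) = / 2) by (field; lra).
  assert (Hr1 : Rabs r <= 1).
  { eapply Rle_trans; [exact Hr|]. assert (0 < / (2 * K)) by (apply Rinv_0_lt_compat; lra). nra. }
  assert (Hc : Rabs (r * cos t) <= Rabs r).
  { rewrite Rabs_mult. generalize (Rabs_pos r) (Rabs_cos_le_1 t). nra. }
  assert (Hp : Rabs (liep d lam (r * cos t)) <= K * Rabs r).
  { eapply Rle_trans; [apply liep_bound; lra|].
    apply Rmult_le_compat; try lra; [|apply Rabs_pos].
    apply lsum_nonneg. intros; apply Rabs_pos. }
  split; [|exact Hp].
  assert (Hsc : Rabs (sin t * cos t * liep d lam (r * cos t)) <= / 2).
  { rewrite Rabs_mult.
    assert (Rabs (sin t * cos t) <= 1)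
      by (apply Rabs_mult_le_1; [apply Rabs_sin_le_1 | apply Rabs_cos_le_1]).
    assert (K * Rabs r <= / 2) by nra.
    generalize (Rabs_pos (liep d lam (r * cos t))). nra. }
  unfold polar_den. apply Rabs_le_between in Hsc.
  rewrite Rabs_left; lra.
Qed.

Lemma polar_rhs_bound d lam t r K :
  lnorm d lam <= K -> 1 <= K -> Rabs r <= / (2 * K) ->
  Rabs (polar_rhs d lam t r) <= 2 * K * Rabs r ^ 2.
Proof.
  intros HK HK1 Hr.
  destruct (polar_den_bound d lam t r K HK HK1 Hr) as [Hd Hp].
  unfold polar_rhs, Rdiv. rewrite !Rabs_mult, Rabs_inv.
  assert (Hi : / Rabs (polar_den d lam t r) <= 2).
  { replace 2 with (/ (1 / 2)) by field. apply Rinv_le_contravar; lra. }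
  assert (Hi0 : 0 < / Rabs (polar_den d lam t r)) by (apply Rinv_0_lt_compat; lra).
  assert (Hs : Rabs (sin t ^ 2) <= 1) by (apply Rabs_pow_le_1, Rabs_sin_le_1).
  assert (Hr0 := Rabs_pos r).
  assert (Hs0 := Rabs_pos (sin t ^ 2)).
  assert (Hl0 := Rabs_pos (liep d lam (r * cos t))).
  assert (A1 : Rabs r * Rabs (liep d lam (r * cos t)) <= K * Rabs r ^ 2) by nra.
  assert (A2 : Rabs r * Rabs (liep d lam (r * cos t)) * Rabs (sin t ^ 2) <= K * Rabs r ^ 2).
  { assert (0 <= Rabs r * Rabs (liep d lam (r * cos t))) by nra. nra. }
  assert (0 <= Rabs r * Rabs (liep d lam (r * cos t)) * Rabs (sin t ^ 2)) by
    (apply Rmult_le_pos; nra).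
  nra.
Qed.

(** The orbit stays comparable to r0 for a whole turn, so integrating the derivative of the
    truncated first integral costs only O(r0^(M+2)). *)
Lemma return_asymptotics d lam M :
  exists eta C, 0 < eta /\ 0 <= C /\
  forall (r0 : R) (y : R -> R), 0 < r0 < eta -> y 0 = r0 ->
    (forall t, 0 <= t <= 2 * PI ->
       polar_den d lam t (y t) <> 0 /\ is_derive y t (polar_rhs d lam t (y t))) ->
    r0 / 2 <= y (2 * PI) <= 3 * r0 / 2 /\
    Rabs (psum lam (words_below d (S M)) (2 * PI) (y (2 * PI)) - r0) <= C * r0 ^ S (S M).
Proof.
  destruct (psum_th_words_bound d lam (S M)) as [C [HC HCb]].
  set (K := lnorm d lam + 1).
  assert (HK0 : 0 <= lnorm d lam) by (apply lsum_nonneg; intros; apply Rabs_pos).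
  assert (HPI := PI_RGT_0). assert (HPI4 := PI_4).
  (* In the second witness, 2 bounds the inverse denominator, 2^(M+2) comes from |y| <= 2 r0, and 2
     pi is the length of the interval. The first gives K r0 <= 1/200, so that |y'| <= 8 K r0^2 <=
     r0/25 and, with 2 pi <= 8, the orbit moves by less than r0/2. *)
  exists (/ (200 * K)), (2 * C * 2 ^ S (S M) * (2 * PI)).
  assert (Heta : K * / (200 * K) = / 200) by (field; unfold K; lra).
  assert (Hhalf : K * / (2 * K) = / 2) by (field; unfold K; lra).
  split; [apply Rinv_0_lt_compat; unfold K; lra|].
  split.
  { apply Rmult_le_pos; [|lra]. apply Rmult_le_pos; [lra|]. apply pow_le; lra. }
  intros r0 y Hr0 Hy0 Hy.
  assert (HKr : K * r0 <= / 200) by (unfold K in *; nra).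
  assert (Hsmall : 2 * r0 <= / (2 * K)).
  { apply Rmult_le_reg_l with K; [unfold K; lra|]. lra. }
  assert (Htrap : forall t, 0 <= t <= 2 * PI -> Rabs (y t - r0) <= r0 / 2).
  { apply (continuity_trap (fun t => y t - r0)); try lra.
    - intros t Ht. apply (ex_derive_continuous (fun t => y t - r0)).
      destruct (Hy t Ht) as [_ Hd].
      auto_derive. now exists (polar_rhs d lam t (y t)).
    - intros t Ht Hs. rewrite <- Hy0 at 1.
      eapply Rle_trans.
      + apply (increment_bound y (fun t => polar_rhs d lam t (y t)) 0 t (8 * K * r0 ^ 2)); [lra|].
        intros s Hs'. split; [apply Hy; lra|].
        assert (Hys : Rabs (y s) <= 2 * r0).
        { assert (A := Hs s Hs'). apply Rabs_le_between in A. apply Rabs_le. lra. }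
        eapply Rle_trans; [apply (polar_rhs_bound d lam s (y s) K); unfold K in *; lra|].
        assert (Rabs (y s) ^ 2 <= (2 * r0) ^ 2)
          by (apply pow_incr; split; [apply Rabs_pos | exact Hys]).
        unfold K in *; nra.
      + assert (8 * K * r0 ^ 2 <= r0 / 25) by nra.
        assert (0 <= 8 * K * r0 ^ 2) by (unfold K in *; nra).
        nra. }
  assert (Hyb : forall t, 0 <= t <= 2 * PI -> Rabs (y t) <= 2 * r0).
  { intros t Ht. assert (A := Htrap t Ht). apply Rabs_le_between in A. apply Rabs_le. lra. }
  split.
  { assert (A := Htrap (2 * PI) ltac:(lra)). apply Rabs_le_between in A. lra. }
  assert (Hr01 : 2 * r0 <= 1) by (unfold K in *; nra).
  set (Phi := fun s => psum lam (words_below d (S M)) s (y s)).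
  assert (HPhi0 : Phi 0 = r0) by (unfold Phi; rewrite psum_0; exact Hy0).
  change (Rabs (Phi (2 * PI) - r0) <= 2 * C * 2 ^ S (S M) * (2 * PI) * r0 ^ S (S M)).
  rewrite <- HPhi0 at 1.
  eapply Rle_trans.
  - apply (increment_bound Phi
      (fun t => psum_th lam (words d (S M)) t (y t) / polar_den d lam t (y t))
      0 (2 * PI) (2 * (C * (2 * r0) ^ S (S M)))); [lra|].
    intros t Ht. destruct (Hy t Ht) as [Hd1 Hd2].
    split; [now apply psum_derive|].
    assert (Hyt := Hyb t Ht).
    destruct (polar_den_bound d lam t (y t) K) as [Hden _]; try (unfold K in *; lra).
    unfold Rdiv. rewrite Rabs_mult, Rabs_inv.
    assert (Hi : / Rabs (polar_den d lam t (y t)) <= 2).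
    { replace 2 with (/ (1 / 2)) by field. apply Rinv_le_contravar; lra. }
    rewrite Rmult_comm. apply Rmult_le_compat; auto using Rabs_pos.
    + left. apply Rinv_0_lt_compat. lra.
    + eapply Rle_trans; [apply HCb; [exact Ht | lra]|].
      apply Rmult_le_compat_l; [exact HC|].
      apply pow_incr. split; [apply Rabs_pos | exact Hyt].
  - rewrite Rpow_mult_distr. right. ring.
Qed.

(** * Uniqueness of asymptotic expansions *)

(** Horner form of the polynomial with coefficients a_0, ..., a_(M-1): removing the constant term
    and dividing by x is then one step of the recursion. *)
Fixpoint hsum (a : nat -> R) (M : nat) (x : R) : R :=
  match M with
  | O => 0
  | S M => a O + x * hsum (fun k => a (S k)) M x
  end.

Lemma hsum_ext M x : forall a b, (forall k, a k = b k) -> hsum a M x = hsum b M x.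
Proof.
  induction M as [|M IH]; simpl; intros a b H; [reflexivity|].
  rewrite H, (IH (fun k => a (S k)) (fun k => b (S k))); auto.
Qed.

Lemma hsum_plus M x : forall a b, hsum (fun k => a k + b k) M x = hsum a M x + hsum b M x.
Proof.
  induction M as [|M IH]; simpl; intros a b; [ring|].
  rewrite (IH (fun k => a (S k)) (fun k => b (S k))). ring.
Qed.

Lemma hsum_opp M x : forall a, hsum (fun k => - a k) M x = - hsum a M x.
Proof.
  induction M as [|M IH]; simpl; intros a; [ring|].
  rewrite (IH (fun k => a (S k))). ring.
Qed.

Lemma hsum_0 M x : hsum (fun _ => 0) M x = 0.
Proof. induction M as [|M IH]; simpl; [reflexivity | rewrite IH; ring]. Qed.

Lemma hsum_bounded M : forall a, exists B, 0 <= B /\ forall x, Rabs x <= 1 -> Rabs (hsum a M x) <= B.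
Proof.
  induction M as [|M IH]; intros a; simpl.
  - exists 0. split; [lra|]. intros. rewrite Rabs_R0. lra.
  - destruct (IH (fun k => a (S k))) as [B [HB HBx]].
    exists (Rabs (a O) + B). split; [generalize (Rabs_pos (a O)); lra|].
    intros x Hx. eapply Rle_trans; [apply Rabs_triang|].
    apply Rplus_le_compat_l. rewrite Rabs_mult.
    specialize (HBx x Hx). generalize (Rabs_pos (hsum (fun k => a (S k)) M x)) (Rabs_pos x). nra.
Qed.

(** The constant term is O(x) at arbitrarily small points, hence 0; divide by x and repeat. Asking
    only for some point below each [eps] matters, because the comparison is made at values of the
    return map. *)
Lemma hsum_small_zero M C : 0 <= C -> forall a,
  (forall eps, 0 < eps -> exists x, 0 < Rabs x < eps /\ Rabs (hsum a M x) <= C * Rabs x ^ M) ->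
  forall k, (k < M)%nat -> a k = 0.
Proof.
  intros HC. induction M as [|M IH]; intros a H; [intros k Hk; lia|].
  assert (Ha0 : a O = 0).
  { destruct (hsum_bounded M (fun k => a (S k))) as [B [HB HBx]].
    destruct (Req_dec (a O) 0) as [|Hne]; [assumption|exfalso].
    assert (Hpos := Rabs_pos_lt _ Hne).
    assert (Hq : 0 < Rabs (a O) / (2 * (B + C + 1))) by (apply Rdiv_lt_0_compat; lra).
    destruct (H (Rmin 1 (Rabs (a O) / (2 * (B + C + 1))))) as [x [[Hx0 Hx] Hs]].
    { apply Rmin_glb_lt; lra. }
    assert (Hx1 := Rlt_le_trans _ _ _ Hx (Rmin_l _ _)).
    assert (Hx2 := Rlt_le_trans _ _ _ Hx (Rmin_r _ _)).
    simpl in Hs. specialize (HBx x (Rlt_le _ _ Hx1)).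
    assert (Hp : Rabs x ^ M <= 1).
    { rewrite <- (pow1 M). apply pow_incr. lra. }
    assert (Hp0 : 0 <= Rabs x ^ M) by (apply pow_le; lra).
    assert (A1 : Rabs (a O) <= Rabs x * (B + C)).
    { replace (a O) with ((a O + x * hsum (fun k => a (S k)) M x)
        + - (x * hsum (fun k => a (S k)) M x)) by ring.
      eapply Rle_trans; [apply Rabs_triang|]. rewrite Rabs_Ropp, Rabs_mult.
      assert (C * (Rabs x * Rabs x ^ M) <= C * Rabs x) by (apply Rmult_le_compat_l; nra).
      assert (Rabs x * Rabs (hsum (fun k => a (S k)) M x) <= Rabs x * B)
        by (apply Rmult_le_compat_l; lra).
      lra. }
    assert (A2 : Rabs x * (2 * (B + C + 1)) < Rabs (a O)).
    { apply Rmult_lt_compat_r with (r := 2 * (B + C + 1)) in Hx2; [|lra].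
      unfold Rdiv in Hx2. rewrite Rmult_assoc, Rinv_l, Rmult_1_r in Hx2 by lra. exact Hx2. }
    nra. }
  intros [|k] Hk; [exact Ha0|].
  apply (IH (fun k => a (S k))); [|lia].
  intros eps Heps. destruct (H eps Heps) as [x [Hx Hs]].
  exists x. split; [exact Hx|].
  simpl in Hs. rewrite Ha0, Rplus_0_l, Rabs_mult in Hs.
  apply Rmult_le_reg_l with (Rabs x); [lra|]. lra.
Qed.

Lemma series_geom_bound (a : nat -> R) K x l :
  (forall k, Rabs (a k * x ^ k) <= K * (/ 2) ^ k) ->
  is_series (fun k => a k * x ^ k) l -> Rabs l <= 2 * K.
Proof.
  intros Hb Hl.
  assert (Hg : is_series (fun k => K * (/ 2) ^ k) (K * / (1 - / 2))).
  { apply (is_series_scal K (fun k => (/ 2) ^ k)). apply is_series_geom.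
    rewrite Rabs_right; lra. }
  rewrite <- (is_series_unique _ _ Hl).
  eapply Rle_trans.
  - apply Series_Rabs.
    apply (@ex_series_le R_AbsRing R_CompleteNormedModule _ (fun k => K * (/ 2) ^ k)).
    + intros k. change (Rabs (Rabs (a k * x ^ k)) <= K * (/ 2) ^ k). rewrite Rabs_Rabsolu. apply Hb.
    + now exists (K * / (1 - / 2)).
  - eapply Rle_trans.
    + apply (Series_le _ (fun k => K * (/ 2) ^ k)).
      * intros k. split; [apply Rabs_pos | apply Hb].
      * now exists (K * / (1 - / 2)).
    + rewrite (is_series_unique _ _ Hg). right. field.
Qed.

(** Each step passes to the shifted series, whose sum is (l - a_0)/x and whose constant is K q;
    after [M] steps the geometric bound 2K applies. *)
Lemma series_remainder M x q : x <> 0 -> 0 <= q -> q * Rabs x <= / 2 ->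
  forall (a : nat -> R) (K l : R), (forall k, Rabs (a k) <= K * q ^ k) ->
  is_series (fun k => a k * x ^ k) l ->
  Rabs (l - hsum a M x) <= 2 * K * q ^ M * Rabs x ^ M.
Proof.
  intros Hx Hq Hqx. induction M as [|M IH]; intros a K l Ha Hl; simpl.
  - rewrite Rminus_0_r, !Rmult_1_r. apply (series_geom_bound a K x); [|exact Hl].
    intros k. rewrite Rabs_mult, <- RPow_abs.
    assert (HK : 0 <= K).
    { specialize (Ha O). simpl in Ha. generalize (Rabs_pos (a O)). lra. }
    apply Rle_trans with (K * q ^ k * Rabs x ^ k).
    + apply Rmult_le_compat_r; [apply pow_le, Rabs_pos | apply Ha].
    + rewrite Rmult_assoc, <- Rpow_mult_distr. apply Rmult_le_compat_l; [exact HK|].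
      apply pow_incr. split; [|exact Hqx]. apply Rmult_le_pos; [exact Hq | apply Rabs_pos].
  - assert (Hl' : is_series (fun k => a (S k) * x ^ k) (/ x * (l - a O))).
    { apply is_series_ext with (fun k => scal (/ x) (a (S k) * x ^ S k)).
      - intros k. change (/ x * (a (S k) * x ^ S k) = a (S k) * x ^ k). simpl. now field.
      - apply (is_series_scal (/ x) (fun k => a (S k) * x ^ S k) (l - a O)).
        apply (is_series_incr_1 (fun k => a k * x ^ k)).
        change (is_series (fun k => a k * x ^ k) (l - a O + a O * x ^ 0)).
        assert (E : l - a O + a O * x ^ 0 = l) by (simpl; ring).
        rewrite E. exact Hl. }
    (* The explicit term only regroups [K * q ^ S k] as [(K * q) * q ^ k]. *)
    assert (A := IH (fun k => a (S k)) (K * q) _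
      (fun k => eq_ind_r (fun z => Rabs (a (S k)) <= z) (Ha (S k))
         (Rmult_assoc K q (q ^ k))) Hl').
    replace (l - (a O + x * hsum (fun k => a (S k)) M x))
      with (x * (/ x * (l - a O) - hsum (fun k => a (S k)) M x)) by (field; exact Hx).
    rewrite Rabs_mult.
    replace (2 * K * (q * q ^ M) * (Rabs x * Rabs x ^ M))
      with (Rabs x * (2 * (K * q) * q ^ M * Rabs x ^ M)) by ring.
    apply Rmult_le_compat_l; [apply Rabs_pos | exact A].
Qed.

Lemma series_coef_bound (a : nat -> R) x :
  x <> 0 -> ex_series (fun k => a k * x ^ k) ->
  exists K, 0 <= K /\ forall k, Rabs (a k) <= K * (/ Rabs x) ^ k.
Proof.
  intros Hx Hs.
  destruct (filterlim_bounded (fun k => a k * x ^ k)) as [K HK].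
  { exists 0. exact (ex_series_lim_0 _ Hs). }
  assert (Hpos := Rabs_pos_lt _ Hx).
  exists K. split.
  { specialize (HK O). generalize (norm_ge_0 (a 0%nat * x ^ 0)). simpl in *. lra. }
  intros k. assert (A : Rabs (a k * x ^ k) <= K) by exact (HK k).
  rewrite Rabs_mult, <- RPow_abs in A.
  rewrite pow_inv.
  apply Rmult_le_reg_r with (Rabs x ^ k); [now apply pow_lt|].
  rewrite Rmult_assoc, Rinv_l, Rmult_1_r; [exact A|].
  apply pow_nonzero. lra.
Qed.

(** * Real parameters: identification of the coefficients *)

Definition word_coef (lam : nat -> R) (T : list (list nat)) (k : nat) : R :=
  lsum (fun w => if (S (list_sum w) =? k)%nat then fst (wcoef w) (2 * PI) * mon lam w else 0) T.

(** If N < M the truncation reproduces the monomial exactly; otherwise it is 0 and |x|^N <=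
    |x|^M. *)
Lemma hsum_single M g x : Rabs x <= 1 -> forall N,
  Rabs (g * x ^ N - hsum (fun k => if (N =? k)%nat then g else 0) M x) <= Rabs g * Rabs x ^ M.
Proof.
  intros Hx. induction M as [|M IH]; intros N.
  - simpl. rewrite Rminus_0_r, Rabs_mult.
    apply Rmult_le_compat_l; [apply Rabs_pos|]. now apply Rabs_pow_le_1.
  - destruct N as [|N].
    + simpl. rewrite hsum_0.
      replace (g * 1 - (g + x * 0)) with 0 by ring. rewrite Rabs_R0.
      apply Rmult_le_pos; [apply Rabs_pos|]. apply (pow_le _ (S M)), Rabs_pos.
    + simpl.
      replace (g * (x * x ^ N) - (0 + x * hsum (fun k => if (N =? k)%nat then g else 0) M x))
        with (x * (g * x ^ N - hsum (fun k => if (N =? k)%nat then g else 0) M x)) by ring.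
      rewrite Rabs_mult.
      replace (Rabs g * (Rabs x * Rabs x ^ M)) with (Rabs x * (Rabs g * Rabs x ^ M)) by ring.
      apply Rmult_le_compat_l; [apply Rabs_pos | apply IH].
Qed.

Lemma psum_hsum lam T M :
  exists C, 0 <= C /\ forall r, Rabs r <= 1 ->
    Rabs (psum lam T (2 * PI) r - hsum (word_coef lam T) M r) <= C * Rabs r ^ M.
Proof.
  induction T as [|w T [C [HC IH]]].
  - exists 0. split; [lra|]. intros r Hr. unfold word_coef, psum. simpl.
    rewrite hsum_0, Rminus_0_r, Rabs_R0. lra.
  - set (g := fst (wcoef w) (2 * PI) * mon lam w).
    exists (Rabs g + C). split; [generalize (Rabs_pos g); lra|].
    intros r Hr.
    rewrite (hsum_ext _ _ (word_coef lam (w :: T))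
      (fun k => (if (S (list_sum w) =? k)%nat then g else 0) + word_coef lam T k))
      by (intros; reflexivity).
    rewrite hsum_plus.
    change (psum lam (w :: T) (2 * PI) r)
      with (g * r ^ S (list_sum w) + psum lam T (2 * PI) r).
    assert (A1 := hsum_single M g r Hr (S (list_sum w))).
    assert (A2 := IH r Hr).
    rewrite Rmult_plus_distr_r.
    eapply Rle_trans; [|apply Rplus_le_compat; [exact A1 | exact A2]].
    eapply Rle_trans; [|apply Rabs_triang]. right. f_equal. ring.
Qed.

Definition rcoef (d : nat) (v : nat -> rpoly) (lam : nat -> R) (k : nat) : R :=
  match k with
  | O => 0
  | S O => 1
  | _ => rpoly_eval d (v k) lam
  end.

(** At x = r(2 pi; r0), both the power series and the word sum equal r0 up to O(x^(M+2)), so their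
    coefficients agree through degree M + 1. Words of length at most [M] suffice, since longer ones
    start at degree M + 2. *)
Lemma return_coef_words d v lam M :
  return_inverse_spec d v ->
  rcoef d v lam (S M) = word_coef lam (words_below d (S M)) (S M).
Proof.
  intros Hspec. destruct (Hspec lam) as [delta [Hdelta [sol Hsol]]].
  destruct (return_asymptotics d lam M) as [eta [C1 [Heta [HC1 Hasym]]]].
  destruct (psum_hsum lam (words_below d (S M)) (S (S M))) as [C2 [HC2 Hps]].
  assert (Hser : forall r0, 0 < r0 < delta ->
    is_series (fun k => rcoef d v lam k * sol (2 * PI) r0 ^ k) r0).
  { intros r0 Hr0. destruct (Hsol r0 ltac:(lra)) as [_ [_ Hs]].
    eapply is_series_ext; [|exact Hs].
    intros [|[|k]]; simpl; try ring. }
  assert (Has : forall r0, 0 < r0 < Rmin delta eta ->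
    r0 / 2 <= sol (2 * PI) r0 <= 3 * r0 / 2 /\
    Rabs (psum lam (words_below d (S M)) (2 * PI) (sol (2 * PI) r0) - r0) <= C1 * r0 ^ S (S M)).
  { intros r0 [Hr0 Hr1].
    assert (A1 := Rlt_le_trans _ _ _ Hr1 (Rmin_l _ _)).
    assert (A2 := Rlt_le_trans _ _ _ Hr1 (Rmin_r _ _)).
    destruct (Hsol r0 ltac:(lra)) as [H0 [Hy _]].
    apply (Hasym r0 (fun t => sol t r0)); [lra | exact H0 | exact Hy]. }
  assert (Hm : 0 < Rmin delta eta) by (apply Rmin_glb_lt; lra).
  set (r1 := Rmin delta eta / 2).
  assert (Hr1 : 0 < r1 < Rmin delta eta) by (unfold r1; lra).
  (* Convergence at this one positive point bounds all coefficients geometrically, with ratio [q] =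
     1/x1. *)
  set (x1 := sol (2 * PI) r1).
  assert (Hx1 : 0 < x1) by (destruct (Has r1 Hr1) as [A _]; unfold x1; lra).
  destruct (series_coef_bound (rcoef d v lam) x1) as [K [HK HKb]].
  { lra. }
  { exists r1. apply Hser. split; [lra|].
    eapply Rlt_le_trans; [apply Hr1 | apply Rmin_l]. }
  set (q := / Rabs x1) in *.
  assert (Hq : 0 < q) by (apply Rinv_0_lt_compat, Rabs_pos_lt; lra).
  apply Rminus_diag_uniq.
  refine (hsum_small_zero (S (S M)) (2 * K * q ^ S (S M) + C1 * 2 ^ S (S M) + C2) _
    (fun k => rcoef d v lam k + - word_coef lam (words_below d (S M)) k) _ (S M) _); [| |lia].
  { assert (0 <= q ^ S (S M)) by (apply pow_le; lra).
    assert (0 <= 2 ^ S (S M)) by (apply pow_le; lra). nra. }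
  intros eps Heps.
  (* Since x <= 3 r0/2, the four bounds give in turn x < eps, x <= 1, q x <= 1/2 and membership in
     the range where [Has] and [Hser] hold. *)
  set (r0 := Rmin (Rmin (eps / 2) (/ 2)) (Rmin (/ (4 * q)) r1)).
  assert (Hr0 : 0 < r0 /\ r0 <= eps / 2 /\ r0 <= / 2 /\ r0 <= / (4 * q) /\ r0 <= r1).
  { assert (0 < / (4 * q)) by (apply Rinv_0_lt_compat; lra).
    unfold r0. split; [repeat apply Rmin_glb_lt; lra|].
    repeat split.
    - eapply Rle_trans; [apply Rmin_l | apply Rmin_l].
    - eapply Rle_trans; [apply Rmin_l | apply Rmin_r].
    - eapply Rle_trans; [apply Rmin_r | apply Rmin_l].
    - eapply Rle_trans; [apply Rmin_r | apply Rmin_r]. }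
  clearbody r0. destruct Hr0 as [Hr0 [Ha [Hb [Hc Hd]]]].
  destruct (Has r0) as [Hx Hpsum]; [lra|].
  assert (Hs : is_series (fun k => rcoef d v lam k * sol (2 * PI) r0 ^ k) r0).
  { apply Hser. split; [lra|]. eapply Rle_lt_trans; [exact Hd|].
    eapply Rlt_le_trans; [apply Hr1 | apply Rmin_l]. }
  set (x := sol (2 * PI) r0) in *. clearbody x.
  exists x. rewrite (Rabs_right x) by lra. split; [lra|].
  assert (Hqx : q * Rabs x <= / 2).
  { rewrite Rabs_right by lra.
    assert (q * / (4 * q) = / 4) by (field; lra). nra. }
  assert (B1 := series_remainder (S (S M)) x q ltac:(lra) (Rlt_le _ _ Hq) Hqx _ K r0 HKb Hs).
  assert (B2 := Hps x ltac:(rewrite Rabs_right; lra)).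
  rewrite (Rabs_right x) in B1, B2 by lra.
  assert (B3 : C1 * r0 ^ S (S M) <= C1 * 2 ^ S (S M) * x ^ S (S M)).
  { rewrite Rmult_assoc, <- Rpow_mult_distr. apply Rmult_le_compat_l; [exact HC1|].
    apply pow_incr. lra. }
  rewrite hsum_plus, hsum_opp.
  set (P := psum lam (words_below d (S M)) (2 * PI) x) in *.
  set (h1 := hsum (rcoef d v lam) (S (S M)) x) in *.
  set (h2 := hsum (word_coef lam (words_below d (S M))) (S (S M)) x) in *.
  replace (h1 + - h2) with (- (r0 - h1) + (- (P - r0) + (P - h2))) by ring.
  eapply Rle_trans; [apply Rabs_triang|]. rewrite Rabs_Ropp.
  eapply Rle_trans; [apply Rplus_le_compat_l, Rabs_triang|]. rewrite Rabs_Ropp.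
  lra.
Qed.

(** * From real to complex parameters *)

Lemma rpoly_evalC_RtoC d P lam :
  rpoly_evalC d P (fun i => RtoC (lam i)) = RtoC (rpoly_eval d P lam).
Proof.
  induction P as [|[c e] P IH]; simpl; [reflexivity|].
  rewrite IH, RtoC_plus, RtoC_mult. do 2 f_equal.
  generalize (seq 1 d). clear. intros l. induction l as [|i l IH]; simpl; [reflexivity|].
  rewrite IH, RtoC_mult. f_equal.
  clear. induction (e i) as [|n IH]; simpl; [reflexivity|].
  rewrite RtoC_mult, <- IH. reflexivity.
Qed.

Lemma rpoly_evalC_ext d P lam mu :
  (forall i, lam i = mu i) -> rpoly_evalC d P lam = rpoly_evalC d P mu.
Proof.
  intros H. induction P as [|[c e] P IH]; simpl; [reflexivity|].
  rewrite IH. do 2 f_equal.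
  generalize (seq 1 d). intros l. induction l as [|i l IHl]; simpl; [reflexivity|].
  now rewrite IHl, H.
Qed.

Definition hornC (l : list R) (z : C) : C :=
  fold_right (fun c acc => Cplus (RtoC c) (Cmult z acc)) (RtoC 0) l.

Fixpoint padd (l1 l2 : list R) : list R :=
  match l1, l2 with
  | nil, _ => l2
  | _, nil => l1
  | a :: l1, b :: l2 => (a + b) :: padd l1 l2
  end.

Lemma hornC_padd z : forall l1 l2, hornC (padd l1 l2) z = Cplus (hornC l1 z) (hornC l2 z).
Proof.
  induction l1 as [|a l1 IH]; intros [|b l2]; simpl; try ring.
  rewrite IH, RtoC_plus. ring.
Qed.

Lemma hornC_scal z c l : hornC (map (Rmult c) l) z = Cmult (RtoC c) (hornC l z).
Proof. induction l as [|a l IH]; simpl; [ring|]. rewrite IH, RtoC_mult. ring. Qed.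

(** Real coefficients are required so that values at real points are real and [hsum_small_zero]
    applies to them. *)
Definition is_polyC (F : C -> C) : Prop := exists l, forall z, F z = hornC l z.

Lemma is_polyC_const c : is_polyC (fun _ => RtoC c).
Proof. exists (c :: nil). intros z. simpl. ring. Qed.

Lemma is_polyC_plus F G : is_polyC F -> is_polyC G -> is_polyC (fun z => Cplus (F z) (G z)).
Proof.
  intros [l1 H1] [l2 H2]. exists (padd l1 l2). intros z. now rewrite hornC_padd, H1, H2.
Qed.

Lemma is_polyC_mult F G : is_polyC F -> is_polyC G -> is_polyC (fun z => Cmult (F z) (G z)).
Proof.
  intros [l1 H1] [l2 H2].
  exists (fold_right (fun a acc => padd (map (Rmult a) l2) (0 :: acc)) nil l1).
  intros z. rewrite H1, H2. clear. induction l1 as [|a l1 IH]; simpl; [ring|].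
  rewrite hornC_padd, hornC_scal. simpl. rewrite <- IH. ring.
Qed.

Lemma is_polyC_evalC d P (a b : nat -> R) :
  is_polyC (fun z => rpoly_evalC d P (fun i => Cplus (RtoC (a i)) (Cmult z (RtoC (b i))))).
Proof.
  induction P as [|[c e] P IH]; simpl; [apply is_polyC_const|].
  apply is_polyC_plus; [|exact IH].
  apply is_polyC_mult; [apply is_polyC_const|].
  generalize (seq 1 d). clear. intros l. induction l as [|i l IH]; simpl; [apply is_polyC_const|].
  apply (is_polyC_mult (fun z => pow_n (Cplus (RtoC (a i)) (Cmult z (RtoC (b i)))) (e i))); [|exact IH].
  induction (e i) as [|n IHn]; simpl; [apply is_polyC_const|].
  apply (is_polyC_mult (fun z => Cplus (RtoC (a i)) (Cmult z (RtoC (b i))))); [|exact IHn].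
  exists (a i :: b i :: nil). intros z. simpl. ring.
Qed.

Lemma hornC_hsum t : forall l, hornC l (RtoC t) = RtoC (hsum (fun k => nth k l 0) (length l) t).
Proof.
  induction l as [|a l IH]; [reflexivity|].
  simpl. rewrite IH, RtoC_plus, RtoC_mult. reflexivity.
Qed.

Lemma hornC_zero l z : (forall t : R, hornC l (RtoC t) = RtoC 0) -> hornC l z = RtoC 0.
Proof.
  intros H.
  assert (Hl : forall k, (k < length l)%nat -> nth k l 0 = 0).
  { apply (hsum_small_zero _ 0); [lra|]. intros eps Heps.
    exists (eps / 2). rewrite Rabs_right by lra. split; [lra|].
    specialize (H (eps / 2)). rewrite hornC_hsum in H. apply RtoC_inj in H.
    rewrite H, Rabs_R0. lra. }
  clear H. induction l as [|a l IH]; [reflexivity|]. simpl.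
  assert (Ha : a = 0) by (apply (Hl O); simpl; lia).
  rewrite Ha, IH; [ring|].
  intros k Hk. apply (Hl (S k)). simpl. lia.
Qed.

(* The restriction of a polynomial to the complex line through [Re lam] with real
   direction [Im lam] is a univariate polynomial, whose value at [Ci] is the value
   at [lam]. *)
Lemma rpoly_evalC_unique d P Q :
  (forall lam, rpoly_eval d P lam = rpoly_eval d Q lam) ->
  forall lam, rpoly_evalC d P lam = rpoly_evalC d Q lam.
Proof.
  intros H lam.
  set (a := fun i => fst (lam i)). set (b := fun i => snd (lam i)).
  destruct (is_polyC_evalC d P a b) as [l1 H1].
  destruct (is_polyC_evalC d Q a b) as [l2 H2].
  assert (Hlam : forall i, lam i = Cplus (RtoC (a i)) (Cmult Ci (RtoC (b i)))).
  { intros i. unfold a, b. destruct (lam i) as [x y].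
    unfold Ci, RtoC, Cplus, Cmult. simpl. f_equal; ring. }
  rewrite !(rpoly_evalC_ext d _ _ _ Hlam), H1, H2.
  assert (Hz : hornC (padd l1 (map (Rmult (-1)) l2)) Ci = RtoC 0).
  { apply hornC_zero. intros t. rewrite hornC_padd, hornC_scal, <- H1, <- H2.
    assert (Hr : forall i, Cplus (RtoC (a i)) (Cmult (RtoC t) (RtoC (b i)))
        = RtoC (a i + t * b i)) by (intros; now rewrite RtoC_plus, RtoC_mult).
    rewrite !(rpoly_evalC_ext d _ _ _ Hr).
    rewrite !(rpoly_evalC_RtoC d _ (fun i => a i + t * b i)), H.
    rewrite <- RtoC_mult, <- RtoC_plus. f_equal. ring. }
  rewrite hornC_padd, hornC_scal in Hz.
  replace (hornC l1 Ci) with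
    (Cplus (Cplus (hornC l1 Ci) (Cmult (RtoC (-1)) (hornC l2 Ci))) (hornC l2 Ci)).
  - rewrite Hz. ring.
  - replace (RtoC (-1)) with (Copp (RtoC 1)) by (unfold Copp, RtoC; simpl; f_equal; ring). ring.
Qed.

Definition cmon (lam : nat -> C) (w : list nat) : C :=
  fold_right (fun i a => Cmult (lam i) a) (RtoC 1) w.

(** Bridge between ordered words and the exponent functions of [rpoly]: the exponent of a parameter
    is the number of its occurrences in the word. *)
Definition count_mon (lam : nat -> C) (w l : list nat) : C :=
  fold_right (fun i a => Cmult (pow_n (lam i) (count_occ Nat.eq_dec w i)) a) (RtoC 1) l.

Lemma count_mon_notin lam x w l :
  ~ In x l -> count_mon lam (x :: w) l = count_mon lam w l.
Proof.
  induction l as [|i l IH]; intros H; [reflexivity|].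
  cbn [count_mon fold_right]. fold (count_mon lam (x :: w) l). fold (count_mon lam w l).
  rewrite IH by (intros A; apply H; now right).
  rewrite count_occ_cons_neq; [reflexivity|]. intros ->. apply H. now left.
Qed.

(** Since [l] has no repetition, the additional occurrence of [x] raises exactly one exponent. *)
Lemma count_mon_in lam x w l :
  NoDup l -> In x l -> count_mon lam (x :: w) l = Cmult (lam x) (count_mon lam w l).
Proof.
  induction l as [|i l IH]; intros Hnd H; [destruct H|].
  inversion_clear Hnd as [|? ? Hi Hl].
  cbn [count_mon fold_right]. fold (count_mon lam (x :: w) l). fold (count_mon lam w l).
  destruct (Nat.eq_dec x i) as [->|Hne].
  - rewrite count_mon_notin, count_occ_cons_eq by auto. simpl pow_n.
    change (@mult C_Ring) with Cmult. ring.
  - destruct H as [H|H]; [congruence|].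
    rewrite IH, count_occ_cons_neq by auto. ring.
Qed.

Lemma count_mon_cmon d lam w :
  (forall i, In i w -> (1 <= i <= d)%nat) -> count_mon lam w (seq 1 d) = cmon lam w.
Proof.
  induction w as [|i w IH]; intros H.
  - generalize (seq 1 d). intros l. induction l as [|i l IHl]; [reflexivity|].
    simpl in *. rewrite IHl. change (@one C_Ring) with (RtoC 1). ring.
  - rewrite count_mon_in.
    + simpl. rewrite IH; [reflexivity|]. intros j Hj. apply H. now right.
    + apply seq_NoDup.
    + apply in_seq. specialize (H i (or_introl eq_refl)). lia.
Qed.

Definition word_poly (T : list (list nat)) (k : nat) : rpoly :=
  map (fun w => (fst (wcoef w) (2 * PI), count_occ Nat.eq_dec w))
    (filter (fun w => (S (list_sum w) =? k)%nat) T).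

Lemma cmon_RtoC lam w : cmon (fun i => RtoC (lam i)) w = RtoC (mon lam w).
Proof. induction w as [|i w IH]; simpl; [reflexivity|]. now rewrite IH, RtoC_mult. Qed.

Lemma Cmod_cmon lam w : Cmod (cmon lam w) = mon (fun i => Cmod (lam i)) w.
Proof. induction w as [|i w IH]; simpl; [apply Cmod_1|]. now rewrite Cmod_mult, IH. Qed.

Lemma word_poly_evalC_cons d lam w T k :
  (forall i, In i w -> (1 <= i <= d)%nat) ->
  rpoly_evalC d (word_poly (w :: T) k) lam =
  Cplus (if (S (list_sum w) =? k)%nat
         then Cmult (RtoC (fst (wcoef w) (2 * PI))) (cmon lam w) else RtoC 0)
        (rpoly_evalC d (word_poly T k) lam).
Proof.
  intros Hw. unfold word_poly. cbn [filter].
  destruct (S (list_sum w) =? k)%nat; [|ring].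
  rewrite <- (count_mon_cmon d) by exact Hw. reflexivity.
Qed.

Lemma word_poly_eval d lam T k :
  (forall w, In w T -> forall i, In i w -> (1 <= i <= d)%nat) ->
  rpoly_eval d (word_poly T k) lam = word_coef lam T k.
Proof.
  (* The passage to complex evaluation allows the conversion of words to exponents to be done once,
     for [C]. *)
  intros HT. apply RtoC_inj. rewrite <- rpoly_evalC_RtoC.
  induction T as [|w T IH]; [reflexivity|].
  rewrite word_poly_evalC_cons by (apply HT; now left).
  rewrite IH by (intros; eapply HT; [right; eassumption | assumption]).
  unfold word_coef. cbn [lsum fold_right]. rewrite RtoC_plus. f_equal.
  destruct (S (list_sum w) =? k)%nat; [|reflexivity].
  now rewrite cmon_RtoC, RtoC_mult.
Qed.

Lemma word_poly_evalC_bound d lam T k :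
  (forall w, In w T -> forall i, In i w -> (1 <= i <= d)%nat) ->
  Cmod (rpoly_evalC d (word_poly T k) lam) <=
  lsum (fun w => if (S (list_sum w) =? k)%nat
                 then Rabs (fst (wcoef w) (2 * PI)) * mon (fun i => Cmod (lam i)) w else 0) T.
Proof.
  intros HT. induction T as [|w T IH].
  - simpl. rewrite Cmod_0. lra.
  - rewrite word_poly_evalC_cons by (apply HT; now left).
    eapply Rle_trans; [apply Cmod_triangle|]. simpl.
    apply Rplus_le_compat.
    + destruct (list_sum w) in *; destruct k as [|k]; try (rewrite Cmod_0; lra);
      match goal with |- context [if ?b then _ else _] => destruct b end;
      try (rewrite Cmod_0; lra);
      rewrite Cmod_mult, Cmod_R, Cmod_cmon; lra.
    + apply IH. intros; eapply HT; [right; eassumption | assumption].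
Qed.

(** * Complex parameters: bounds *)

Lemma mon_nonneg mu w : (forall i, 0 <= mu i) -> 0 <= mon mu w.
Proof.
  intros H. induction w as [|i w IH]; simpl; [lra|]. now apply Rmult_le_pos.
Qed.

(** Expanding the m-th power of the letter sum without commuting factors yields one term per
    word. *)
Lemma words_mon_sum d mu s m :
  lsum (fun w => mon mu w * s ^ list_sum w) (words d m)
  = lsum (fun i => mu i * s ^ i) (seq 1 d) ^ m.
Proof.
  induction m as [|m IH]; [simpl; ring|].
  simpl words. rewrite lsum_flat_map, <- tech_pow_Rmult, <- IH.
  rewrite Rmult_comm, <- lsum_scal. apply lsum_ext. intros i _.
  rewrite lsum_map, Rmult_comm, <- lsum_scal. apply lsum_ext. intros w _.
  change (list_sum (i :: w)) with (i + list_sum w)%nat.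
  change (mon mu (i :: w)) with (mu i * mon mu w). rewrite pow_add. ring.
Qed.

Lemma words_below_mon_sum d mu s M :
  0 <= lsum (fun i => mu i * s ^ i) (seq 1 d) <= / 2 ->
  lsum (fun w => mon mu w * s ^ list_sum w) (words_below d M) <= 2 - 2 * (/ 2) ^ M.
Proof.
  intros Hq. induction M as [|M IH]; [simpl; lra|].
  simpl words_below. rewrite lsum_app, words_mon_sum.
  assert (lsum (fun i => mu i * s ^ i) (seq 1 d) ^ M <= (/ 2) ^ M) by (apply pow_incr; lra).
  simpl. lra.
Qed.

Lemma lam_norm_nonneg d lam : 0 <= lam_norm d lam.
Proof. apply (lsum_nonneg _ (fun i => Cmod (lam i))). intros; apply Cmod_ge_0. Qed.

(** The number of words of weight [N] is never counted. Each word gets the factor s^|w|, compensated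
    by enlarging 18 to 36 (1 + |lambda|); with s = 1/(2(1 + |lambda|)) the letter sum is at most
    1/2, and all words together contribute at most 2, uniformly in [M]. *)
Lemma word_poly_evalC_geom d lam M N :
  Cmod (rpoly_evalC d (word_poly (words_below d M) (S N)) lam)
  <= 2 * (36 * (1 + lam_norm d lam)) ^ N.
Proof.
  assert (HL := lam_norm_nonneg d lam).
  set (La := 1 + lam_norm d lam). set (mu := fun i => Cmod (lam i)).
  set (s := / (2 * La)).
  assert (Hs : 0 < s) by (apply Rinv_0_lt_compat; unfold La; lra).
  assert (HsL : s * La = / 2) by (unfold s; field; unfold La; lra).
  assert (Hs1 : s <= 1) by (unfold La in *; nra).
  assert (HPI := PI_RGT_0). assert (HPI4 := PI_4).
  assert (Hmu : forall i, 0 <= mu i) by (intros; apply Cmod_ge_0).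
  eapply Rle_trans.
  { apply word_poly_evalC_bound. intros w Hw. now apply words_below_letters with M. }
  (* Words of the wrong weight, which contributed 0, are readmitted with a nonnegative term, so that
     the sum factors by length. *)
  apply Rle_trans with
    (lsum (fun w => (36 * La) ^ N * (mon mu w * s ^ list_sum w)) (words_below d M)).
  - apply lsum_le. intros w Hw.
    assert (Hm := mon_nonneg mu w Hmu).
    destruct (S (list_sum w) =? S N)%nat eqn:E.
    + apply Nat.eqb_eq in E. injection E as <-.
      assert (Hc : Rabs (fst (wcoef w) (2 * PI)) <= 18 ^ list_sum w).
      { eapply Rle_trans.
        - apply wcoef_bound; [|lra].
          intros i Hi. now apply (words_below_letters d M w Hw).
        - apply pow_incr. lra. }
      replace ((36 * La) ^ list_sum w * (mon mu w * s ^ list_sum w))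
        with (mon mu w * ((36 * La) * s) ^ list_sum w)
        by (rewrite (Rpow_mult_distr (36 * La) s); ring).
      replace (36 * La * s) with 18 by (replace (36 * La * s) with (36 * (s * La)) by ring; lra).
      fold mu. rewrite Rmult_comm. now apply Rmult_le_compat_l.
    + apply Rmult_le_pos; [apply pow_le; unfold La; lra|].
      apply Rmult_le_pos; [exact Hm | apply pow_le; lra].
  - rewrite lsum_scal, Rmult_comm.
    apply Rmult_le_compat_r; [apply pow_le; unfold La; lra|].
    eapply Rle_trans; [apply words_below_mon_sum|].
    + split.
      * apply lsum_nonneg. intros i. apply Rmult_le_pos; [apply Hmu | apply pow_le; lra].
      * apply Rle_trans with (lsum (fun i => s * mu i) (seq 1 d)).
        -- apply lsum_le. intros i Hi. apply in_seq in Hi.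
           destruct i as [|i]; [lia|]. simpl.
           assert (s ^ i <= 1) by (rewrite <- (pow1 i); apply pow_incr; lra).
           assert (s * s ^ i <= s) by nra.
           rewrite Rmult_comm. apply Rmult_le_compat_r; [apply Hmu | lra].
        -- rewrite lsum_scal.
           change (lsum mu (seq 1 d)) with (lam_norm d lam). unfold La in *. nra.
    + assert (0 < (/ 2) ^ M) by (apply pow_lt; lra). lra.
Qed.

Lemma fcoef_bound d v lam N :
  return_inverse_spec d v ->
  Cmod (fcoef d v lam (S N)) <= 2 * (36 * (1 + lam_norm d lam)) ^ N.
Proof.
  intros Hspec. destruct N as [|N].
  - simpl. rewrite Cmod_1. lra.
  - simpl fcoef.
    (* The coefficient has index N + 2, hence weight N + 1, and words of length at most N + 1 cover
       it. *)
    rewrite (rpoly_evalC_unique d _ (word_poly (words_below d (S (S N))) (S (S N)))).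
    + apply word_poly_evalC_geom.
    + intros mu. rewrite word_poly_eval by (intros w Hw; now apply words_below_letters with (S (S N))).
      exact (return_coef_words d v mu (S N) Hspec).
Qed.

(** 256 is 64 times 4: the power of 2 in the denominator exceeds c^n by a factor 64 (from c <= 2 pi
    <= 8), and pi^2 >= 4. It is above the 4 * 36 = 144 that the condition Q |x| <= 1/4 demands. *)
Lemma Rprime_bound d lam : (2 <= d)%nat -> Rprime d lam * (256 * (1 + lam_norm d lam)) <= 1.
Proof.
  intros Hd. unfold Rprime.
  assert (Hn : (1 <= d / 2)%nat) by (apply Nat.div_le_lower_bound; lia).
  set (n := (d / 2)%nat) in *. clearbody n.
  assert (HL := lam_norm_nonneg d lam). set (La := 1 + lam_norm d lam).
  assert (HPI := PI_RGT_0). assert (HPI4 := PI_4). assert (HPI2 := PI2_1).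
  assert (Hc : 0 <= c_odd n <= 8).
  { assert (Hcont : forall t, continuous (fun t => cos t ^ (2 * n) * sin t ^ 2) t).
    { intros t. apply (ex_derive_continuous (fun t => cos t ^ (2 * n) * sin t ^ 2)).
      auto_derive. trivial. }
    assert (Hex : ex_RInt (fun t => cos t ^ (2 * n) * sin t ^ 2) 0 (2 * PI))
      by (apply (@ex_RInt_continuous R_CompleteNormedModule); intros; apply Hcont).
    unfold c_odd. split.
    - apply RInt_ge_0; [lra | exact Hex|].
      intros t _. rewrite pow_mult. apply Rmult_le_pos; [apply pow_le|]; apply pow2_ge_0.
    - apply Rle_trans with (RInt (fun _ => 1) 0 (2 * PI)).
      + apply RInt_le; [lra | exact Hex | apply ex_RInt_const|].
        intros t _. eapply Rle_trans; [apply Rle_abs|].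
        apply Rabs_mult_le_1; apply Rabs_pow_le_1; [apply Rabs_cos_le_1 | apply Rabs_sin_le_1].
      + rewrite RInt_const. change (scal (2 * PI - 0) 1) with ((2 * PI - 0) * 1). lra. }
  assert (Hcn : c_odd n ^ n <= 8 ^ n) by (apply pow_incr; exact Hc).
  (* As n >= 1, the subtraction is not truncated: the right side is 1024^n = 128^n 8^n. *)
  assert (H2 : 128 * 8 ^ n <= 2 * 2 ^ (10 * n - 1)).
  { replace (2 * 2 ^ (10 * n - 1)) with ((2 ^ 10) ^ n)
      by (rewrite <- pow_mult, tech_pow_Rmult; f_equal; lia).
    replace (2 ^ 10) with (128 * 8) by ring. rewrite Rpow_mult_distr.
    apply Rmult_le_compat_r; [apply pow_le; lra|].
    rewrite <- (pow_1 128) at 1. apply Rle_pow; [lra | exact Hn]. }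
  assert (Hn1 : 1 <= INR n) by (apply (le_INR 1); exact Hn).
  assert (HLa : La <= La ^ (4 * n + 1)).
  { rewrite <- (pow_1 La) at 1. apply Rle_pow; [unfold La; lra | lia]. }
  assert (Hpi : 4 <= PI ^ 2) by nra.
  assert (H8 : 0 < 8 ^ n) by (apply pow_lt; lra).
  set (A := 2 ^ (10 * n - 1)) in *. set (B := La ^ (4 * n + 1)) in *.
  assert (HA : 64 * 8 ^ n <= A) by lra.
  assert (H3 : A <= A * INR n) by nra.
  assert (H4 : 256 * 8 ^ n <= A * INR n * PI ^ 2) by nra.
  assert (HLa0 : 1 <= La) by (unfold La; lra).
  assert (H5 : 256 * 8 ^ n * La <= A * INR n * PI ^ 2 * B) by (apply Rmult_le_compat; lra).
  assert (HD : 0 < A * INR n * PI ^ 2 * B) by nra.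
  apply Rmult_le_reg_r with (A * INR n * PI ^ 2 * B); [exact HD|].
  unfold Rdiv.
  replace (c_odd n ^ n * / (A * INR n * PI ^ 2 * B) * (256 * La) * (A * INR n * PI ^ 2 * B))
    with (256 * c_odd n ^ n * La)
    by (field; repeat split; try (intros E; rewrite E in *; lra); lra).
  nra.
Qed.

(** * Power series close to the identity *)

Lemma Cmod_pow_n (z : C) n : Cmod (pow_n z n) = Cmod z ^ n.
Proof.
  induction n as [|n IH]; [apply Cmod_1|].
  simpl. rewrite <- IH. apply Cmod_mult.
Qed.

Lemma sum_n_C_S (u : nat -> C) n : sum_n u (S n) = Cplus (sum_n u n) (u (S n)).
Proof. exact (sum_Sn u n). Qed.

Lemma sum_n_C_0 (u : nat -> C) : sum_n u 0 = u 0%nat.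
Proof. exact (sum_O u). Qed.

Lemma pow_n_C_S (z : C) n : pow_n z (S n) = Cmult z (pow_n z n).
Proof. reflexivity. Qed.

Lemma near_identity_term (a : nat -> C) (Q : R) (z : C) n :
  (forall n, Cmod (a (S n)) <= 2 * Q ^ n) -> Q * Cmod z <= / 4 -> 0 <= Q ->
  Cmod (Cmult (a (S n)) (pow_n z (S n))) <= 2 * Cmod z * (/ 4) ^ n.
Proof.
  intros Ha Hz HQ. rewrite Cmod_mult, Cmod_pow_n.
  assert (Hz0 := Cmod_ge_0 z).
  apply Rle_trans with (2 * Q ^ n * Cmod z ^ S n).
  - apply Rmult_le_compat_r; [now apply pow_le | apply Ha].
  - replace (2 * Q ^ n * Cmod z ^ S n) with (2 * Cmod z * (Q * Cmod z) ^ n)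
      by (rewrite Rpow_mult_distr; simpl; ring).
    apply Rmult_le_compat_l; [lra|]. apply pow_incr. split; [nra | exact Hz].
Qed.

Lemma near_identity_ex_series (a : nat -> C) (Q : R) (z : C) :
  (forall n, Cmod (a (S n)) <= 2 * Q ^ n) -> Q * Cmod z <= / 4 -> 0 <= Q ->
  ex_series (fun k => Cmult (a k) (pow_n z k)).
Proof.
  intros Ha Hz HQ.
  apply (ex_series_incr_1 (V := C_NormedModule)).
  apply (@ex_series_le R_AbsRing C_R_CompleteNormedModule
    (fun n => Cmult (a (S n)) (pow_n z (S n))) (fun n => 2 * Cmod z * (/ 4) ^ n)).
  - intros n. rewrite <- Cmod_norm. now apply near_identity_term with Q.
  - apply (@ex_series_scal R_AbsRing R_NormedModule (2 * Cmod z) (fun n => (/ 4) ^ n)).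
    apply ex_series_geom. rewrite Rabs_right; lra.
Qed.

(** The linear term z dominates the rest, which is at most (2/3)|z|; partial sums therefore stay at
    distance at least |z|/3 from 0. *)
Lemma near_identity_zero (a : nat -> C) (Q : R) (z : C) :
  a O = RtoC 0 -> a 1%nat = RtoC 1 ->
  (forall n, Cmod (a (S n)) <= 2 * Q ^ n) -> Q * Cmod z <= / 4 -> 0 <= Q ->
  is_series (fun k => Cmult (a k) (pow_n z k)) (RtoC 0) -> z = RtoC 0.
Proof.
  intros H0 H1 Ha Hz HQ Hs.
  set (u := fun k => Cmult (a k) (pow_n z k)) in *.
  assert (Hz0 := Cmod_ge_0 z).
  assert (Hpart : forall n, Cmod (Cminus (sum_n u (S n)) z) <= 2 / 3 * Cmod z * (1 - (/ 4) ^ n)).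
  { induction n as [|n IH].
    - rewrite sum_n_C_S, sum_n_C_0. unfold u. rewrite H0, H1, pow_n_C_S.
      change (pow_n z 0) with (RtoC 1).
      replace (Cminus _ z) with (RtoC 0) by ring. rewrite Cmod_0. simpl. lra.
    - rewrite sum_n_C_S.
      replace (Cminus (Cplus (sum_n u (S n)) (u (S (S n)))) z)
        with (Cplus (Cminus (sum_n u (S n)) z) (u (S (S n)))) by ring.
      eapply Rle_trans; [apply Cmod_triangle|].
      assert (A := near_identity_term a Q z (S n) Ha Hz HQ). fold (u (S (S n))) in A.
      simpl in *. lra. }
  destruct (Req_dec (Cmod z) 0) as [Hz'|Hne]; [now apply Cmod_eq_0|exfalso].
  assert (Hlim : is_lim_seq (fun n => Cmod (sum_n u (S n))) 0).
  { apply (is_lim_seq_incr_1 (fun n => Cmod (sum_n u n))).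
    assert (A := filterlim_comp _ _ _ (sum_n u) norm _ _ _ Hs
      (@filterlim_norm C_AbsRing C_NormedModule (RtoC 0))).
    assert (E : @norm C_AbsRing C_NormedModule (RtoC 0) = 0) by apply Cmod_0.
    rewrite E in A. exact A. }
  assert (Hle : Rbar_le (Cmod z / 3) 0).
  { apply (is_lim_seq_le (fun _ => Cmod z / 3) (fun n => Cmod (sum_n u (S n)))).
    - intros n. assert (A := Hpart n).
      assert (0 < (/ 4) ^ n) by (apply pow_lt; lra).
      assert (B := Cmod_triangle (sum_n u (S n)) (Copp (Cminus (sum_n u (S n)) z))).
      rewrite Cmod_opp in B.
      replace (Cplus (sum_n u (S n)) (Copp (Cminus (sum_n u (S n)) z))) with z in B by ring.
      nra.
    - apply is_lim_seq_const.
    - exact Hlim. }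
  simpl in Hle. lra.
Qed.

(** For order 2 or more, the condition j = 1 at the origin would say a_1 = 0: with z^0 = 1 and all
    other powers 0, every partial sum equals a_1 = 1. *)
Lemma zero_order_at_0 (a : nat -> C) m :
  a 1%nat = RtoC 1 -> zero_order_ge a (RtoC 0) m -> (m <= 1)%nat.
Proof.
  intros H1 H. apply Nat.nlt_ge. intros Hm. specialize (H 1%nat Hm).
  set (u := fun k => _) in H.
  assert (Hu : forall n, @eq C (sum_n u n) (RtoC 1)).
  { induction n as [|n IH].
    - rewrite sum_n_C_0. unfold u. change (pow_n (RtoC 0) 0) with (RtoC 1).
      simpl (0 + 1)%nat. rewrite H1. simpl. replace (1 / 1) with 1 by field. ring.
    - rewrite sum_n_C_S, IH. unfold u at 1. rewrite pow_n_C_S. ring. }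
  assert (A := filterlim_comp _ _ _ (sum_n u) norm _ _ _ H
      (@filterlim_norm C_AbsRing C_NormedModule (RtoC 0))).
  assert (E : @norm C_AbsRing C_NormedModule (RtoC 0) = 0) by apply Cmod_0.
  rewrite E in A.
  assert (B : is_lim_seq (fun n => Cmod (sum_n u n)) 0) by exact A.
  assert (B1 : is_lim_seq (fun n => Cmod (sum_n u n)) 1).
  { apply is_lim_seq_ext with (fun _ => 1); [|apply is_lim_seq_const].
    intros n. now rewrite Hu, Cmod_1. }
  apply is_lim_seq_unique in B, B1. rewrite B in B1. injection B1. lra.
Qed.

Theorem mainTheorem9 (d : nat) (v : nat -> rpoly) :
  (2 <= d)%nat ->
  return_inverse_spec d v ->
  forall lam : nat -> C,
    (forall x : C, Cmod x < Rprime d lam ->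
       ex_series (fun k : nat => Cmult (fcoef d v lam k) (pow_n x k))) /\
    (forall zs : list (C * nat),
       NoDup (map fst zs) ->
       (forall zm, In zm zs ->
          Cmod (fst zm) < Rprime d lam /\ zero_order_ge (fcoef d v lam) (fst zm) (snd zm)) ->
       (fold_right (fun zm acc => snd zm + acc) 0 zs <= 2 * (d / 2))%nat).
Proof.
  intros Hd Hspec lam.
  assert (HL := lam_norm_nonneg d lam).
  set (Q := 36 * (1 + lam_norm d lam)).
  assert (HQ : 0 <= Q) by (unfold Q; lra).
  assert (Ha : forall n, Cmod (fcoef d v lam (S n)) <= 2 * Q ^ n)
    by (intros; now apply fcoef_bound).
  assert (HR := Rprime_bound d lam Hd).
  assert (HQR : forall x, Cmod x < Rprime d lam -> Q * Cmod x <= / 4).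
  { intros x Hx. unfold Q. generalize (Cmod_ge_0 x). nra. }
  split.
  { intros x Hx. apply near_identity_ex_series with Q; auto. }
  assert (Hn : (1 <= d / 2)%nat) by (apply Nat.div_le_lower_bound; lia).
  intros zs Hnd Hzs.
  (* A positive multiplicity includes the condition j = 0, that is f(z) = 0, which forces z = 0; an
     entry may also carry multiplicity 0 at any point. *)
  assert (Hm : forall z m, In (z, m) zs ->
    (z = RtoC 0 /\ (m <= 1)%nat) \/ m = 0%nat).
  { intros z m Hin. destruct (Hzs _ Hin) as [Hz Hord]. simpl in Hz, Hord.
    destruct m as [|m]; [now right|left].
    assert (E : z = RtoC 0).
    { apply (near_identity_zero (fcoef d v lam) Q); auto.
      eapply is_series_ext; [|apply (Hord 0%nat); lia].
      intros k. cbv beta. rewrite Nat.add_0_r.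
      replace (INR (Factorial.fact k) / INR (Factorial.fact k)) with 1
        by (field; apply INR_fact_neq_0).
      match goal with |- ?x = ?y => change (@eq C x y) end. ring. }
    split; [exact E|]. rewrite E in Hord.
    now apply zero_order_at_0 with (2 := Hord). }
  (* The points are distinct, so at most one entry sits at the origin and the total is at most 1,
     while 2n >= 2. *)
  enough (H : (fold_right (fun zm acc => snd zm + acc) 0 zs <= 1)%nat) by lia.
  clear Hzs. induction zs as [|[z m] zs IH]; simpl; [lia|].
  inversion_clear Hnd as [|? ? Hz Hzs]. simpl in Hz.
  destruct (Hm z m (or_introl eq_refl)) as [[E Hm1]| ->].
  - enough (fold_right (fun zm acc => snd zm + acc) 0 zs = 0)%nat by lia.
    clear IH Hzs.
    assert (H0 : forall zm, In zm zs -> snd zm = 0%nat).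
    { intros [z' m'] Hin. destruct (Hm z' m' (or_intror Hin)) as [[E' _]|]; [|assumption].
      exfalso. apply Hz. rewrite E, <- E'. exact (in_map fst zs (z', m') Hin). }
    clear - H0. induction zs as [|zm zs IH]; simpl; [reflexivity|].
    rewrite (H0 zm), IH; simpl; auto. intros; apply H0; now right.
  - apply IH; [exact Hzs|]. intros; apply Hm; now right.
Qed.
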